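(* Let $k$ be a perfect field, let $K$ be a finite Galois extension of $k$ with Galois group $\Gamma=\mathrm{Gal}(K/k)$, let $x$ be transcendental over $K$, and let $F$ be an algebraic function field with full constant field $K$ which is a finite Galois extension of the rational function field $K(x)$, with Galois group $G=\mathrm{Gal}(F/K(x))$. Assume that $F/K$ can be reduced to $F'/k$ (see context). Then: (1) $F/k(x)$ is Galois, and its Galois group $\mathcal{G}$ is the semidirect product $G\rtimes \Gamma$ of the normal subgroup $G$ and the subgroup $\mathrm{Gal}(F/F')\cong\Gamma$. (2) Moreover, if $H$ is a subgroup of $G$ such that its fixed field $E=F^H$ (as a function field over $K$) can be reduced to an algebraic function field $E'/k$, then $F/E'$ is Galois with Galois group $\mathcal{H}=H\rtimes\Gamma$ (semidirect product of $H$ and a subgroup isomorphic to $\Gamma$). In particular, $G$ and $H$ are stabilised under the action by conjugation (inner automorphisms) of the subgroup isomorphic to $\Gamma$.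
   Context: All fields are subfields of a fixed algebraically closed field. Descent/reduction: let $E$ be an algebraic function field of one variable with full constant field $K$, viewed as a finite extension of $K(x)$ with $x$ transcendental over $K$, and let $k\subset K$. One says $E/K$ can be reduced to $E'/k$ (the descent of the definition field from $K$ to $k$ is possible) if $E'$ is an extension of $k(x)$ with full constant field $k$ such that $E$ is isomorphic as a $k$-algebra to $E'\otimes_k K$ (i.e. $E=E'K$).
   Formalization: In (2), the splitting of Gal(F/E') as H⋊Γ and the stability of H under Gal(F/F') are proved only if E' is contained in F', as they fail for arbitrary E'; for every E' it is proved that F/E' is Galois, H is normal in Gal(F/E') and the quotient is isomorphic to Γ. *)

(* Defs.v *)
From HB Require Import structures.
From mathcomp Require Export all_boot all_order all_algebra all_fingroup.
From mathcomp Require Export all_solvable all_field.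

Set Implicit Arguments.
Unset Strict Implicit.
Unset Printing Implicit Defensive.

Import GRing.Theory.

Local Open Scope ring_scope.

(* All the function fields at stake are finite over k(x) = Frac k[X].  The
   common overfield in which they are taken is a finite normal extension L of
   k(x); every finite extension of k(x) embeds in such an L (its normal
   closure), so fixing L loses no generality.  Subfields of L containing k(x)
   are of type {subfield L}, and k(x) itself is 1 : {subfield L}.  The constant
   fields k and K are not k(x)-subspaces of L: they are given by embeddings. *)
Notation ratfun k := {fraction {poly k}}.

Definition perfect_field (k : fieldType) : Prop :=
  forall p : {poly k}, irreducible_poly p -> separable_poly p.

Definition const_embed (k : fieldType) (L : fieldExtType (ratfun k)) (c : k) : L :=
  (FracField.tofrac (c%:P : {poly k}))%:A.

Definition ratfun_var (k : fieldType) (L : fieldExtType (ratfun k)) : L :=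
  (FracField.tofrac ('X : {poly k}))%:A.

(* iota embeds K in L over k. *)
Definition const_field_embedding (k : fieldType) (K : fieldExtType k)
    (L : fieldExtType (ratfun k)) (iota : {rmorphism K -> L}) : Prop :=
  forall c : k, iota c%:A = const_embed L c.

Definition full_constant_field (k C : fieldType) (L : fieldExtType (ratfun k))
    (j : C -> L) (E : {subfield L}) : Prop :=
  forall z : L, (exists c : C, z = j c) <-> (z \in E /\ algebraicOver j z).

(* The field EK; adjoining a k-basis of K is enough (see sub_compositum).  In
   particular compositum iota 1 is K(x). *)
Definition compositum (k : fieldType) (K : fieldExtType k)
    (L : fieldExtType (ratfun k)) (iota : {rmorphism K -> L})
    (E : {subfield L}) : {subfield L} :=
  <<E & [seq iota b | b <- vbasis {:K}]>>%AS.

Lemma sub_compositum (k : fieldType) (K : fieldExtType k)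
    (L : fieldExtType (ratfun k)) (iota : {rmorphism K -> L})
    (hiota : const_field_embedding iota) (E M : {subfield L}) :
  (compositum iota E <= M)%VS <->
  (E <= M)%VS /\ (forall a : K, iota a \in M).
Proof.
split=> [/Fadjoin_seqP[sEM sKM] | [sEM sKM]].
  split=> // a; rewrite (coord_vbasis (memvf a)) rmorph_sum rpred_sum //= => i _.
  rewrite -mulr_algl rmorphM hiota; apply: rpredM.
    exact/rpredZ/rpred1.
  by apply/sKM/map_f/mem_nth; rewrite size_tuple ltn_ord.
apply/Fadjoin_seqP; split=> // y /mapP[a _ ->]; exact: sKM.
Qed.

(* E/K is reduced to E'/k: E' contains k(x) by its type, has full constant
   field k, and E = E'K. *)
Definition reduces_to (k : fieldType) (K : fieldExtType k)
    (L : fieldExtType (ratfun k)) (iota : {rmorphism K -> L})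
    (E E' : {subfield L}) : Prop :=
  full_constant_field (@const_embed k L) E' /\
  E = compositum iota E' :> {vspace L}.

(* Main.v *)
(* Let E have full constant field k.  Restriction to K embeds Gal(EK/E) into
   Gamma, and it is onto: an element of K fixed by the image lies in E and is
   algebraic over k, hence lies in k.  So for every automorphism s of L over
   k(x) there is some x in Gal(EK/E) with the same restriction to K, and
   x^-1 s fixes K(x) pointwise.  If EK/K(x) is Galois, both factors of
   s = x (x^-1 s) preserve EK, so EK/k(x) is Galois; if s fixes A <= E, then
   x^-1 s lies in Gal(EK/AK), which gives Gal(EK/A) = Gal(EK/AK) Gal(EK/E).
   The two parts of the theorem are the cases A = k(x) and A = E'. *)
Require Import Defs.

Set Implicit Arguments.
Unset Strict Implicit.
Unset Printing Implicit Defensive.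

Local Open Scope ring_scope.
Local Open Scope group_scope.

Import GRing.Theory.

Section ConstantFieldExtension.

Variables (k : fieldType) (K : splittingFieldType k).
Hypothesis galK : galois 1%VS {:K}%AS.
Variables (L : splittingFieldType (ratfun k)) (iota : {rmorphism K -> L}).
Hypothesis iota_k : const_field_embedding iota.

Implicit Types (A E F M : {subfield L}) (s : 'AEnd(L)).

Local Notation Gamma := 'Gal({:K} / 1)%G.

Lemma iota_mem1 (a : K) : a \in 1%VS -> iota a \in 1%VS.
Proof. by case/vlineP=> c ->; rewrite iota_k rpredZ ?rpred1. Qed.

Lemma map_iota_over1 (p : {poly K}) :
  p \is a polyOver 1%VS -> map_poly iota p \is a polyOver 1%VS.
Proof.
by move=> /polyOverP p1; apply/polyOverP=> i; rewrite coef_map iota_mem1.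
Qed.

Lemma map_AEnd_iota s (p : {poly K}) :
  p \is a polyOver 1%VS -> map_poly s (map_poly iota p) = map_poly iota p.
Proof. by move=> p1; rewrite (kHom_poly_id (k1AHom {:L} s)) ?map_iota_over1. Qed.

(** A primitive element [t] of K over k goes under [s] to a root of the image of its minimal
    polynomial, since [s] fixes the coefficients; these roots are the images under [iota] of the
    conjugates [g t]. The existential is informative so that [restrict_const] can be its first
    projection. *)
Lemma AEnd_iota s :
  {g | g \in Gamma & forall a : K, s (iota a) = iota (g a)}.
Proof.
have [_ sepK _] := and3P galK; pose t := separable_generator 1 {:K}.
(* At [t] alone the condition is a boolean equality, so [sig2W] can turn mere existence into a
   choice of [g]. *)
have [g gG Dg] : {g | g \in Gamma & s (iota t) == iota (g t)}.
  apply: sig2W; have [r [/subsetP rG _ Dp]] := elimT (galois_factors (sub1v _)) galK t (memvf t).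
  have: root (map_poly iota (minPoly 1 t)) (s (iota t)).
    by rewrite -(map_AEnd_iota s) ?minPolyOver // !fmorph_root root_minPoly.
  rewrite Dp map_prod_XsubC -(big_map iota predT (fun b => 'X - b%:P)%R).
  rewrite root_prod_XsubC => /mapP[_ /mapP[g rg ->] ->].
  by exists g; rewrite ?rG.
exists g => // a; have: a \in <<1; t>>%VS.
  by rewrite -(eq_adjoin_separable_generator sepK (sub1v _)) memvf.
case/Fadjoin_polyP=> p p1 ->.
rewrite -!horner_map /= map_AEnd_iota // (eqP Dg) (kHom_poly_id (k1AHom {:K} g)) //.
Qed.

Lemma iota_compositum E (a : K) : iota a \in compositum iota E.
Proof. by have /(sub_compositum iota_k)[_] := subvv (compositum iota E); apply. Qed.

Lemma sub_compositum_base E : (E <= compositum iota E)%VS.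
Proof. by have /(sub_compositum iota_k)[] := subvv (compositum iota E). Qed.

Lemma compositumS E M : (E <= M)%VS -> (compositum iota E <= compositum iota M)%VS.
Proof.
move=> sEM; apply/(sub_compositum iota_k); split=> [|a].
  exact: subv_trans sEM (sub_compositum_base M).
exact: iota_compositum.
Qed.

(** The points fixed by [s] form a subfield, so the universal property of the compositum applies. *)
Lemma compositum_fixed E s :
    {in E, forall z, s z = z} -> (forall a, s (iota a) = iota a) ->
  {in compositum iota E, forall z, s z = z}.
Proof.
move=> sE sK; suffices /subvP sub: (compositum iota E <= fixedSpace s)%VS.
  by move=> z /sub/fixedSpaceP.
apply/(sub_compositum iota_k E (fixedSpace_aspace s)).
split=> [|a]; last exact/fixedSpaceP/sK.
by apply/subvP=> z Ez; apply/fixedSpaceP/sE.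
Qed.

(** As [iota] maps k into k(x), hence into E, it maps polynomial expressions over k in the elements
    of [rs] into E(iota rs); the induction adjoins one generator at a time. *)
Lemma iota_adjoin E (rs : seq K) (a : K) :
  a \in <<1 & rs>>%VS -> iota a \in <<E & [seq iota b | b <- rs]>>%VS.
Proof.
elim/last_ind: rs a => [|rs b IHrs] a.
  by rewrite !Fadjoin_nil => /iota_mem1; apply/subvP/sub1v.
rewrite map_rcons !adjoin_rcons => /Fadjoin_polyP[p /polyOverP p1 ->].
rewrite -horner_map mempx_Fadjoin //.
by apply/polyOverP=> i; rewrite coef_map IHrs.
Qed.

(** K is the splitting field over k of a separable polynomial; the image of that polynomial under
    [iota] stays separable, and its roots generate EK over E. *)
Lemma galois_compositum E : galois E (compositum iota E).
Proof.
have /splitting_galoisField[p [p1 sep_p [rs Dp defK]]] := galK.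
apply/splitting_galoisField; exists (map_poly iota p); split.
- exact/(polyOverSv (sub1v E))/map_iota_over1.
- by rewrite separable_map.
exists [seq iota b | b <- rs].
  by rewrite big_map -map_prod_XsubC eqp_map.
apply/eqP; rewrite eqEsubv; apply/andP; split.
  apply/Fadjoin_seqP; split; first exact: sub_compositum_base.
  by move=> _ /mapP[b _ ->]; apply: iota_compositum.
apply/(sub_compositum iota_k); split=> [|a]; first exact: subv_adjoin_seq.
by apply: iota_adjoin; rewrite defK memvf.
Qed.

Definition restrict_const M (x : gal_of M) : gal_of {:K} := s2val (AEnd_iota x).
Arguments restrict_const : clear implicits.

Lemma restrict_constE M (x : gal_of M) (a : K) :
  iota (restrict_const M x a) = x (iota a).
Proof. by rewrite /restrict_const; case: (AEnd_iota x). Qed.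

Lemma restrict_const_Gamma M (x : gal_of M) : restrict_const M x \in Gamma.
Proof. by rewrite /restrict_const; case: (AEnd_iota x). Qed.

Section Compositum.

Variable E : {subfield L}.

Local Notation M := (compositum iota E).

Lemma restrict_constM :
  {in 'Gal(M / E) &, {morph restrict_const M : x y / x * y}}.
Proof.
move=> x y _ _; apply/eqP/gal_eqP=> a _; apply: (fmorph_inj iota).
by rewrite galM ?memvf // !restrict_constE galM ?iota_compositum.
Qed.

Canonical restrict_const_morphism := Morphism restrict_constM.

Lemma injm_restrict_const : 'injm restrict_const_morphism.
Proof.
apply/subsetP=> x; rewrite 2!inE => /andP[Ex /set1P /= rx1].
apply/set1P/eqP/gal_eqP=> z Mz; rewrite gal_id.
apply: compositum_fixed Mz => [y Ey | a].
  by apply: fixed_gal Ex Ey; apply: sub_compositum_base.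
by rewrite -restrict_constE rx1 gal_id.
Qed.

Hypothesis E_const : full_constant_field (@const_embed k L) E.

Lemma im_restrict_const : restrict_const M @* 'Gal(M / E) = Gamma.
Proof.
apply/eqP; rewrite eqEsubset; apply/andP; split.
  by apply/subsetP=> _ /morphimP[x _ _ ->]; apply: restrict_const_Gamma.
(* The image is the Galois group of its own fixed field, so it suffices that this fixed field be
   contained in k. *)
rewrite -(gal_fixedField (restrict_const_morphism @* _)%G) /=; apply: galS.
apply/subvP=> a /mem_fixedFieldP[_ fix_a].
have Ea: iota a \in E.
  rewrite -(galois_fixedField (galois_compositum E)).
  apply/fixedFieldP=> [|x Ex]; first exact: iota_compositum.
  by rewrite -restrict_constE fix_a ?mem_morphim.
(* The minimal polynomial of [a] over k, read in k[X], is an algebraic relation for [iota a]. *)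
have alg_a: algebraicOver (@const_embed k L) (iota a).
  have /polyOver1P[q Dq] := minPolyOver 1 a; exists q.
    by rewrite -(map_poly_eq0 (in_alg K)) -Dq monic_neq0 ?monic_minPoly.
  rewrite (eq_map_poly (fun c => esym (iota_k c))) (map_poly_comp iota).
  by rewrite -Dq fmorph_root root_minPoly.
have [_ /(_ (conj Ea alg_a))[c Dc]] := E_const (iota a).
have /fmorph_inj-> : iota a = iota c%:A by rewrite iota_k.
by rewrite rpredZ ?rpred1.
Qed.

Lemma gal_compositum_isog : 'Gal(M / E) \isog Gamma.
Proof.
apply/isogP; exists restrict_const_morphism; first exact: injm_restrict_const.
exact: im_restrict_const.
Qed.

Lemma gal_compositum_lift s :
  exists2 x, x \in 'Gal(M / E) & forall a, x (iota a) = s (iota a).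
Proof.
have [g gG Dg] := AEnd_iota s.
have: g \in restrict_const M @* 'Gal(M / E) by rewrite im_restrict_const.
case/morphimP=> x _ Ex Dx; exists x => // a.
by rewrite Dg Dx restrict_constE.
Qed.

End Compositum.


(** [F] is a variable with an equation so that the result applies to groups in [gal_of F], a type
    that depends on [F]. *)
Lemma gal_compositum_sdprod A E F :
    full_constant_field (@const_embed k L) E -> F = compositum iota E ->
    (A <= E)%VS -> galois A F ->
  'Gal(F / compositum iota A) ><| 'Gal(F / E) = 'Gal(F / A).
Proof.
move=> E_const -> sAE galAM; set M := compositum iota E.
have sEM : (E <= M)%VS := sub_compositum_base E.
have sAcM : (compositum iota A <= M)%VS := compositumS sAE.
have sAcA := sub_compositum_base A.
have nsGA : 'Gal(M / compositum iota A) <| 'Gal(M / A).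
  apply: normalField_normal; rewrite ?sAcA ?sAcM //.
  by have /and3P[] := galois_compositum A.
have sEA : 'Gal(M / E) \subset 'Gal(M / A) := galS _ sAE.
rewrite sdprodE; last 2 first.
- exact: subset_trans sEA (normal_norm nsGA).
- apply/trivgP/subsetP=> x /setIP[Gx Ex]; apply/set1P/eqP/gal_eqP=> z Mz.
  rewrite gal_id; apply: compositum_fixed Mz => [y | a].
    exact: fixed_gal Ex.
  by apply: fixed_gal Gx _ => //; apply: iota_compositum.
apply/eqP; rewrite eqEsubset mul_subG ?(normal_sub nsGA) //.
apply/subsetP=> s As; have [x Ex xK] := gal_compositum_lift E_const s.
(* Products in [gal_of] act left factor first, so [s * x^-1] applies [s] and then undoes [x], which
   agrees with [s] on K. *)
rewrite -(mulgKV x s) mem_mulg // gal_kHom //; apply/kAHomP.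
have Ax := subsetP sEA x Ex.
apply: compositum_fixed => [z Az | a].
  by apply: fixed_gal Az; rewrite ?groupM ?groupV // (subv_trans sAE).
rewrite galM ?iota_compositum // -xK -galM ?iota_compositum //.
by rewrite mulgV gal_id.
Qed.

Lemma galois_descent E F :
    full_constant_field (@const_embed k L) E -> F = compositum iota E ->
    galois (compositum iota 1%AS) F ->
  galois 1%VS F.
Proof.
move=> E_const -> galM; set M := compositum iota E in galM *.
have /and3P[s1cM sep1c nM] := galM.
have /and3P[_ sep1 _] := galois_compositum 1%AS.
rewrite /galois sub1v (separable_trans sep1 sep1c) /=.
apply/forall_inP=> s _.
have [x Ex xK] := gal_compositum_lift E_const s.
(* It is not yet known that [s] preserves M, so it is corrected by [x] in ['AEnd(L)] and not in
   [gal_of M]; normality of M over K(x) then applies to [t]. *)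
pose t : 'AEnd(L) := (x^-1 \o s)%AF.
have tM : (t @: M = M)%VS.
  apply/eqP/(forall_inP nM); rewrite inE kAutfE; apply/kAHomP.
  apply: compositum_fixed => [z /vlineP[c ->] | a].
    by rewrite linearZ /= rmorph1.
  by rewrite /t /= comp_lfunE /= -xK lker0_lfunK ?AEnd_lker0.
have -> : s = (x \o t)%AF.
  by apply: val_inj; apply/lfunP=> z; rewrite !comp_lfunE /= lker0_lfunVK ?AEnd_lker0.
by rewrite limg_comp tM limg_gal.
Qed.

End ConstantFieldExtension.

Theorem theorem2p3
  (k : fieldType) (k_perfect : perfect_field k)
  (K : splittingFieldType k) (galK : galois 1%VS {:K}%AS)
  (L : splittingFieldType (ratfun k))
  (iota : {rmorphism K -> L}) (iota_k : const_field_embedding iota)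
  (x_transc : ~ algebraicOver iota (ratfun_var L))
  (F : {subfield L}) (F_const : full_constant_field iota F)
  (galF : galois (compositum iota 1%AS) F)
  (F' : {subfield L}) (redF : reduces_to iota F F') :
  let Gamma := 'Gal({:K} / 1)%G in
  let G := 'Gal(F / compositum iota 1%AS)%G in
  let GF' := 'Gal(F / F')%G in
  [/\ galois 1%VS F,
      G ><| GF' = 'Gal(F / 1),
      GF' \isog Gamma,
      GF' \subset 'N(G)
    & forall (H : {group gal_of F}) (E' : {subfield L}),
        H \subset G -> reduces_to iota (fixedField H)%AS E' ->
        [/\ galois E' F,
            H <| 'Gal(F / E'),
            'Gal(F / E') / H \isog Gamma
          & (E' <= F')%VS ->
            H ><| GF' = 'Gal(F / E') /\ GF' \subset 'N(H)]].
Proof.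
move=> Gamma G GF'; have [F'_const /val_inj defF] := redF.
have gal1F : galois 1%VS F := galois_descent galK iota_k F'_const defF galF.
have defG : G ><| GF' = 'Gal(F / 1).
  by apply: (gal_compositum_sdprod galK iota_k F'_const defF); rewrite ?sub1v.
split=> //.
- by rewrite /GF' defF; apply: gal_compositum_isog.
- by have [_ _ nGG' _] := sdprodP defG.
move=> H E' sHG [E'_const defE].
have sE'E : (E' <= fixedField H)%VS by rewrite defE sub_compositum_base.
have sEF : (fixedField H <= F)%VS := fixedField_bound H.
have galE'F : galois E' F.
  by apply: galoisS gal1F; rewrite sub1v (subv_trans sE'E).
have galE'E : galois E' (fixedField H) by rewrite defE; apply: galois_compositum.
(* E'K is the fixed field of H, so the Galois correspondence returns H. *)
have defH : 'Gal(F / compositum iota E') = H by rewrite -defE gal_fixedField.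
have nE : normalField E' (fixedField H) by have /and3P[] := galE'E.
have sE'EF : (E' <= fixedField_aspace H <= F)%VS by rewrite sE'E.
have nsH : H <| 'Gal(F / E').
  by rewrite -{1}[H : {set _}]gal_fixedField; apply: normalField_normal nE.
split=> // [|sE'F'].
  (* Restriction to E'K identifies the quotient by H with Gal(E'K/E'), which is isomorphic to
     Gamma. *)
  have := normalField_isog galE'F sE'EF nE.
  rewrite gal_fixedField => /isog_trans; apply.
  have /val_inj -> : val (fixedField_aspace H) = compositum iota E' by [].
  exact: gal_compositum_isog.
(* The inclusion of E' in F' places Gal(F/F') inside Gal(F/E'), so the same copy of Gamma that
   complements G also complements H. *)
have defH' := gal_compositum_sdprod galK iota_k F'_const defF sE'F' galE'F.
rewrite defH in defH'; split=> //.
by have [_ _ nHF' _] := sdprodP defH'.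
Qed.
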